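(* Let $(C_{\leq_C},\alpha,\gamma,A_{\leq_A})$ be a Galois insertion with $\langle C,\leq_C\rangle$ a complete lattice, and let $f:C\to C$ be monotonic. Assume that the binary join $\vee_A:A\times A\to A$ and the map $\alpha f\gamma:A\to A$ are computable, that the partial order $\leq_A$ is decidable, and that $A$ is a CPO satisfying the ascending chain condition. For all $c\in C$ such that $\alpha(c)$ is computable and all $a'\in A$, the following procedure $\mathrm{AInv}(f,A,c,a')$: 1. set $i:=\alpha(c)$; 2. while $i\leq_A a'$: if $\alpha f\gamma(i)\leq_A i$, return $i$; otherwise set $i:=\alpha(c)\vee_A\alpha f\gamma(i)$; 3. return ''no abstract inductive invariant for $f$ and $\langle c,\gamma(a')\rangle$''; is a terminating algorithm which outputs the least (with respect to $\leq_A$) abstract inductive invariant for $f$ and $\langle c,\gamma(a')\rangle$ when an abstract inductive invariant for $f$ and $\langle c,\gamma(a')\rangle$ exists, and otherwise outputs ''no abstract inductive invariant''.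
   Context: A Galois connection between posets $\langle C,\leq_C\rangle$ and $\langle A,\leq_A\rangle$ is a pair of maps $\alpha:C\to A$, $\gamma:A\to C$ with $\alpha(c)\leq_A a\iff c\leq_C\gamma(a)$ for all $c\in C,a\in A$; it is a Galois insertion when $\alpha$ is surjective. $\alpha f\gamma$ denotes $\alpha\circ f\circ\gamma$. The ascending chain condition: there is no infinite sequence of distinct elements $x_0\leq_A x_1\leq_A\cdots$. A CPO is a poset with least upper bounds of all directed subsets. An abstract inductive invariant for $f$ and $\langle c,c'\rangle\in C^2$ is an element $a\in A$ such that $c\leq_C\gamma(a)$, $f(\gamma(a))\leq_C\gamma(a)$ and $\gamma(a)\leq_C c'$. *)

(* Defs.v *)
From HB Require Import structures.
From mathcomp Require Import all_boot all_order.
From mathcomp Require Import boolp classical_sets.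

Set Implicit Arguments.
Unset Strict Implicit.
Unset Printing Implicit Defensive.

Local Open Scope classical_set_scope.
Local Open Scope order_scope.

(* The orders below are those of MathComp, hence bool-valued.  In the presence
   of the classical axioms of boolp this restricts neither the posets nor their
   orders; effectiveness is expressed only by [computable2] and its variants. *)

Section Posets.
Context {d : Order.disp_t} {T : porderType d}.

Definition complete_lattice : Prop :=
  forall S : set T, (exists s, supremums S s) /\ (exists s, infimums S s).

Definition directed (S : set T) : Prop :=
  S !=set0 /\
  forall x y, S x -> S y -> exists z, [/\ S z, x <= z & y <= z].

Definition cpo : Prop :=
  forall S : set T, directed S -> exists s, supremums S s.

Definition ascending_chain_condition : Prop :=
  ~ exists x : nat -> T, injective x /\ forall n, x n <= x n.+1.

End Posets.
Arguments complete_lattice {d} T.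
Arguments cpo {d} T.
Arguments ascending_chain_condition {d} T.

Section Galois.
Context {dC dA : Order.disp_t} {C : porderType dC} {A : porderType dA}.
Variables (alpha : C -> A) (gamma : A -> C).

Definition galois_connection : Prop :=
  forall c a, (alpha c <= a) <-> (c <= gamma a).

Definition galois_insertion : Prop :=
  galois_connection /\ forall a, exists c, alpha c = a.

End Galois.

Section Invariants.
Context {dC dA : Order.disp_t} {C : porderType dC} {A : porderType dA}.
Variables (gamma : A -> C) (f : C -> C) (c c' : C).

Definition abstract_inductive_invariant (a : A) : Prop :=
  [/\ c <= gamma a, f (gamma a) <= gamma a & gamma a <= c'].

Definition least_abstract_inductive_invariant (a : A) : Prop :=
  abstract_inductive_invariant a /\
  forall b, abstract_inductive_invariant b -> a <= b.

End Invariants.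

Section Procedure.
Context {dC dA : Order.disp_t} {C : porderType dC} {A : joinSemilatticeType dA}.
Variables (alpha : C -> A) (gamma : A -> C) (f : C -> C).

(* [AInv_loop c a' i r]: the while loop, entered with the variable set to [i],
   terminates with output [r].  [None] is the output "no abstract inductive
   invariant".  The three cases are mutually exclusive and exhaustive, so the
   loop diverges from [i] exactly when there is no such [r]. *)
Inductive AInv_loop (c : C) (a' : A) : A -> option A -> Prop :=
| AInv_exit i :
    ~ (i <= a') -> AInv_loop c a' i None
| AInv_return i :
    i <= a' -> alpha (f (gamma i)) <= i -> AInv_loop c a' i (Some i)
| AInv_iterate i r :
    i <= a' -> ~ (alpha (f (gamma i)) <= i) ->
    AInv_loop c a' (alpha c `|` alpha (f (gamma i))) r ->
    AInv_loop c a' i r.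

Definition AInv (c : C) (a' : A) : option A -> Prop :=
  AInv_loop c a' (alpha c).

End Procedure.

(* Programs for the partial recursive functions.  Arities are not tracked by
   the type: a program is run on a list of arguments. *)
Inductive recfun : Type :=
| RZero
| RSucc
| RProj of nat
| RComp of recfun & seq recfun
| RPrec of recfun & recfun
| RMin of recfun.

Local Open Scope nat_scope.

(* [reval p v y]: the program [p] halts on the arguments [v] with value [y]. *)
Inductive reval : recfun -> seq nat -> nat -> Prop :=
| reval_zero v :
    reval RZero v 0
| reval_succ x v :
    reval RSucc (x :: v) x.+1
| reval_proj i v :
    i < size v -> reval (RProj i) v (nth 0 v i)
| reval_comp g hs v ws y :
    size ws = size hs ->
    (forall i, i < size hs -> reval (nth RZero hs i) v (nth 0 ws i)) ->
    reval g ws y ->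
    reval (RComp g hs) v y
| reval_prec0 g h v y :
    reval g v y -> reval (RPrec g h) (0 :: v) y
| reval_precS g h n v z y :
    reval (RPrec g h) (n :: v) z -> reval h [:: n, z & v] y ->
    reval (RPrec g h) (n.+1 :: v) y
| reval_min g v n (w : nat -> nat) :
    (forall i, i < n -> reval g (i :: v) (w i).+1) ->
    reval g (n :: v) 0 ->
    reval (RMin g) v n.

(* A numbering is a partial map assigning to some natural numbers, the names,
   the element that they represent.  An element may have several names, or
   none; the set of names need not be decidable. *)
Definition numbering (X : Type) : Type := nat -> option X.

Definition names {X : Type} (nu : numbering X) (n : nat) (x : X) : Prop :=
  nu n = Some x.

Definition bool_numbering : numbering bool := fun n =>
  match n with 0 => Some false | 1 => Some true | _ => None end.

Definition option_numbering {X : Type} (nu : numbering X) :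
  numbering (option X) := fun n =>
  match n with 0 => Some None | m.+1 => omap Some (nu m) end.

Definition computable0 {X : Type} (nu : numbering X) (x : X) : Prop :=
  exists (p : recfun) (k : nat), reval p [::] k /\ names nu k x.

Definition computable1 {X Y : Type} (nuX : numbering X) (nuY : numbering Y)
    (g : X -> Y) : Prop :=
  exists p : recfun, forall n x, names nuX n x ->
    exists k, reval p [:: n] k /\ names nuY k (g x).

Definition computable2 {X Y Z : Type} (nuX : numbering X) (nuY : numbering Y)
    (nuZ : numbering Z) (g : X -> Y -> Z) : Prop :=
  exists p : recfun, forall n m x y, names nuX n x -> names nuY m y ->
    exists k, reval p [:: n; m] k /\ names nuZ k (g x y).

Definition decidable_rel {X : Type} (nu : numbering X) (e : rel X) : Prop :=
  computable2 nu nu bool_numbering e.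

(* Main.v *)
(** The iterates of [a |-> alpha c `|` alpha (f (gamma a))] from [alpha c] ascend
    and lie below every invariant, so the ascending chain condition makes the
    loop stop, at the least invariant if there is one below [a'].  Every iterate
    has a name, even those beyond the end of the loop, so a program may search
    for the first iterate at which the loop stops by unbounded minimization over
    primitive recursion. *)
Require Import Defs.
From mathcomp Require Import all_boot all_order.
From mathcomp Require Import boolp classical_sets.

Set Implicit Arguments.
Unset Strict Implicit.

Import Order.TTheory.

(** * Abstract inductive invariants of a Galois insertion *)

Section GaloisInsertion.
Context {dC dA : Order.disp_t} {C : porderType dC} {A : porderType dA}.
Variables (alpha : C -> A) (gamma : A -> C).

Lemma galois_alpha_homo :
  galois_connection alpha gamma -> {homo alpha : x y / (x <= y)%O}.
Proof.
move=> adj x y le_xy; apply/adj; apply: le_trans le_xy _.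
exact/(adj y (alpha y)).
Qed.

Lemma galois_gamma_homo :
  galois_connection alpha gamma -> {homo gamma : a b / (a <= b)%O}.
Proof.
move=> adj a b le_ab; apply/(adj (gamma a) b).
by apply: le_trans le_ab; apply/adj.
Qed.

(** Surjectivity gives [a = alpha x]; then [x <= gamma (alpha x) <= gamma b], and the adjunction
    moves [gamma] back across. *)
Lemma galois_insertion_gamma_le (a b : A) :
  galois_insertion alpha gamma -> (gamma a <= gamma b)%O -> (a <= b)%O.
Proof.
case=> adj surj le_gab; have [x xa] := surj a.
rewrite -xa in le_gab *; apply/adj.
by apply: le_trans le_gab; apply/(adj x (alpha x)).
Qed.

(** This moves all three conditions into [A], where the loop performs its tests. The first two are
    adjunctions; the last one needs the insertion. *)
Lemma abstract_inductive_invariantE (f : C -> C) (c : C) (a' a : A) :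
  galois_insertion alpha gamma ->
  abstract_inductive_invariant gamma f c (gamma a') a <->
  [/\ alpha c <= a, alpha (f (gamma a)) <= a & a <= a']%O.
Proof.
move=> hGI; have [adj _] := hGI; split=> -[h1 h2 h3]; split.
- exact/adj.
- exact/adj.
- exact: galois_insertion_gamma_le h3.
- exact/adj.
- exact/adj.
- exact: galois_gamma_homo h3.
Qed.

End GaloisInsertion.

(** * Ascending iteration of a monotone map *)

Lemma ascending_chain_stationary {d : Order.disp_t} {T : porderType d}
    (x : nat -> T) :
  ascending_chain_condition T -> (forall n, x n <= x n.+1)%O ->
  exists n, x n.+1 = x n.
Proof.
move=> acc x_le; apply: contrapT => /forallNP nstat; apply: acc; exists x.
(* A sequence that is nowhere stationary increases strictly, so it is injective. *)
split=> //; apply/inc_inj/le_mono.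
apply: (@homo_ltn _ _ (fun a b => (a < b)%O)) => [b a e|n].
  exact: lt_trans.
by rewrite lt_neqAle x_le andbT eq_sym; apply/negP => /eqP/nstat.
Qed.

Section JoinIteration.
Context {d : Order.disp_t} {A : joinSemilatticeType d}.
Variables (F : A -> A) (a0 : A).
Hypothesis F_homo : {homo F : x y / (x <= y)%O}.

Definition join_iter (t : nat) : A := iter t (fun a => Order.join a0 (F a)) a0.

Lemma join_iter_ge (t : nat) : (a0 <= join_iter t)%O.
Proof. by case: t => [|t] /=; rewrite ?leUl. Qed.

Lemma join_iter_le_succ (t : nat) : (join_iter t <= join_iter t.+1)%O.
Proof.
elim: t => [|t IH]; first exact: join_iter_ge.
by rewrite /= leU2 // F_homo.
Qed.

Lemma join_iter_le_postfixpoint (b : A) (t : nat) :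
  (a0 <= b)%O -> (F b <= b)%O -> (join_iter t <= b)%O.
Proof.
move=> le_a0 le_F; elim: t => [//|t IH] /=.
by rewrite leUx le_a0 (le_trans _ le_F) // F_homo.
Qed.

(** Where the iteration is stationary, the iterate equals a join one of whose terms is its own image
    under [F]. *)
Lemma join_iter_postfixpoint :
  ascending_chain_condition A -> exists t, (F (join_iter t) <= join_iter t)%O.
Proof.
move=> acc; have [t tE] := ascending_chain_stationary acc join_iter_le_succ.
by exists t; rewrite -[X in (_ <= X)%O]tE leUr.
Qed.

End JoinIteration.

(** * From the iterates to a run of the loop *)

Section LoopExit.
Context {dC dA : Order.disp_t} {C : porderType dC} {A : joinSemilatticeType dA}.
Variables (alpha : C -> A) (gamma : A -> C) (f : C -> C) (c : C) (a' : A).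

Let F (a : A) : A := alpha (f (gamma a)).
Let x : nat -> A := join_iter F (alpha c).

Lemma AInv_join_iter (T : nat) :
  (forall t, t < T -> (x t <= a')%O && ~~ (F (x t) <= x t)%O) ->
  ~~ ((x T <= a')%O && ~~ (F (x T) <= x T)%O) ->
  AInv alpha gamma f c a' (if (x T <= a')%O then Some (x T) else None).
Proof.
move=> cont; rewrite negb_and negbK => stop.
(* A run is derived backwards from its exit, so the induction is on the distance [k] to [T]; [k = T]
   is the entry of the loop. *)
suff loop k : k <= T -> AInv_loop alpha gamma f c a' (x (T - k))
    (if (x T <= a')%O then Some (x T) else None).
  by have := loop T (leqnn T); rewrite subnn.
elim: k => [_|k IH lt_kT].
  rewrite subn0; case: ifPn stop => [le_a' /= le_F|/negP nle_a' _].
    exact: AInv_return.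
  exact: AInv_exit.
have /andP[le_a' /negP nle_F] : (x (T - k.+1) <= a')%O &&
    ~~ (F (x (T - k.+1)) <= x (T - k.+1))%O.
  by apply: cont; rewrite ltn_subrL (leq_trans _ lt_kT).
apply: AInv_iterate => //; have := IH (ltnW lt_kT).
by rewrite -subSS subSn.
Qed.

End LoopExit.

(** * Boolean programs *)

Lemma reval_comp1 (g h : recfun) (v : seq nat) (x y : nat) :
  reval h v x -> reval g [:: x] y -> reval (RComp g [:: h]) v y.
Proof. by move=> hx; apply: reval_comp => // -[]. Qed.

Lemma reval_comp2 (g h1 h2 : recfun) (v : seq nat) (x1 x2 y : nat) :
  reval h1 v x1 -> reval h2 v x2 -> reval g [:: x1; x2] y ->
  reval (RComp g [:: h1; h2]) v y.
Proof. by move=> h1x h2x; apply: reval_comp => // -[|[]]. Qed.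

Lemma reval_comp3 (g h1 h2 h3 : recfun) (v : seq nat) (x1 x2 x3 y : nat) :
  reval h1 v x1 -> reval h2 v x2 -> reval h3 v x3 ->
  reval g [:: x1; x2; x3] y -> reval (RComp g [:: h1; h2; h3]) v y.
Proof. by move=> h1x h2x h3x; apply: reval_comp => // -[|[|[]]]. Qed.

Lemma names_boolP (k : nat) (b : bool) : names bool_numbering k b -> k = b.
Proof. by case: k => [|[|k]] // [<-]. Qed.

(** Primitive recursion acts as a case distinction, here and in the next two programs: the base
    handles [false], the step handles [true]. *)
Definition rec_not : recfun := RPrec (RComp RSucc [:: RZero]) RZero.

Lemma reval_not (b : bool) : reval rec_not [:: nat_of_bool b] (~~ b).
Proof.
have r0 : reval rec_not [:: 0] 1.
  apply: reval_prec0; apply: reval_comp1; first exact: reval_zero.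
  exact: reval_succ.
by case: b => //=; apply: reval_precS r0 _; apply: reval_zero.
Qed.

(** This is the shape of the condition for another iteration; its value 0 is what [RMin] searches
    for. *)
Definition rec_andnot : recfun := RPrec RZero (RComp rec_not [:: RProj 2]).

Lemma reval_andnot (b1 b2 : bool) :
  reval rec_andnot [:: nat_of_bool b1; nat_of_bool b2] (b1 && ~~ b2).
Proof.
have r0 : reval rec_andnot [:: 0; nat_of_bool b2] 0.
  by apply: reval_prec0; apply: reval_zero.
case: b1 => //=; apply: reval_precS r0 _.
by apply: reval_comp1 (reval_not b2); apply: (@reval_proj 2).
Qed.

(** The values follow [option_numbering]: 0 names [None], a successor names a [Some]. *)
Definition rec_guard_succ : recfun :=
  RPrec RZero (RComp RSucc [:: RProj 2]).

Lemma reval_guard_succ (b : bool) (k : nat) :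
  reval rec_guard_succ [:: nat_of_bool b; k] (if b then k.+1 else 0).
Proof.
have r0 : reval rec_guard_succ [:: 0; k] 0.
  by apply: reval_prec0; apply: reval_zero.
case: b => //=; apply: reval_precS r0 _.
by apply: reval_comp1 (reval_succ k [::]); apply: (@reval_proj 2).
Qed.

(** * The program for the procedure *)

Section Program.
Context {d : Order.disp_t} {A : joinSemilatticeType d}.
Variables (nu : numbering A) (F : A -> A) (pj pf pl : recfun).
Hypothesis pjP : forall n m x y, names nu n x -> names nu m y ->
  exists k, reval pj [:: n; m] k /\ names nu k (Order.join x y).
Hypothesis pfP : forall n x, names nu n x ->
  exists k, reval pf [:: n] k /\ names nu k (F x).
Hypothesis plP : forall n m x y, names nu n x -> names nu m y ->
  exists k, reval pl [:: n; m] k /\ names bool_numbering k (x <= y)%O.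

(** In the recursion step, index 1 holds the name of the current iterate and index 2 the name of the
    starting element. *)
Definition rec_join_iter : recfun :=
  RPrec (RProj 0) (RComp pj [:: RProj 2; RComp pf [:: RProj 1]]).

Definition rec_continue : recfun :=
  RComp
    (RComp rec_andnot
      [:: RComp pl [:: RProj 0; RProj 1];
          RComp pl [:: RComp pf [:: RProj 0]; RProj 0]])
    [:: rec_join_iter; RProj 2].

(** Minimization yields only the stopping index, so the iterate is computed again from it; one more
    comparison tells the two exits apart. *)
Definition rec_AInv : recfun :=
  RComp (RComp rec_guard_succ [:: RComp pl [:: RProj 0; RProj 1]; RProj 0])
    [:: RComp rec_join_iter [:: RMin rec_continue; RProj 0; RProj 1]; RProj 1].

Lemma reval_le (n m : nat) (x y : A) :
  names nu n x -> names nu m y -> reval pl [:: n; m] (x <= y)%O.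
Proof.
by move=> nx my; have [k [rk /names_boolP kE]] := plP nx my; rewrite -kE.
Qed.

Variables (a0 a' : A) (n m : nat).
Hypotheses (n_a0 : names nu n a0) (m_a' : names nu m a').

Let x : nat -> A := join_iter F a0.

Lemma reval_join_iter (t : nat) :
  exists k, reval rec_join_iter [:: t; n; m] k /\ names nu k (x t).
Proof.
elim: t => [|t [k [rk k_x]]].
  by exists n; split=> //; apply: reval_prec0; apply: (@reval_proj 0).
have [l [rl l_F]] := pfP k_x; have [j [rj j_x]] := pjP n_a0 l_F.
exists j; split=> //; apply: reval_precS rk _.
apply: reval_comp2 rj; first exact: (@reval_proj 2).
by apply: reval_comp1 rl; apply: (@reval_proj 1).
Qed.

Lemma reval_continue (t : nat) :
  reval rec_continue [:: t; n; m] ((x t <= a')%O && ~~ (F (x t) <= x t)%O).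
Proof.
have [k [rk k_x]] := reval_join_iter t; have [l [rl l_F]] := pfP k_x.
apply: reval_comp2 rk (@reval_proj 2 [:: t; n; m] isT) _.
apply: reval_comp2 (reval_andnot _ _).
  apply: reval_comp2 (reval_le k_x m_a').
    exact: (@reval_proj 0).
  exact: (@reval_proj 1).
apply: reval_comp2 (reval_le l_F k_x); last exact: (@reval_proj 0).
by apply: reval_comp1 rl; apply: (@reval_proj 0).
Qed.

Lemma reval_AInv (T : nat) :
  (forall t, t < T -> (x t <= a')%O && ~~ (F (x t) <= x t)%O) ->
  ~~ ((x T <= a')%O && ~~ (F (x T) <= x T)%O) ->
  exists k, reval rec_AInv [:: n; m] k /\
    names (option_numbering nu) k (if (x T <= a')%O then Some (x T) else None).
Proof.
move=> cont /negbTE stop; have [k [rk k_x]] := reval_join_iter T.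
exists (if (x T <= a')%O then k.+1 else 0); split; last first.
  by case: ifP => // _; rewrite /names /= (k_x : nu k = _).
apply: (@reval_comp2 _ _ _ _ k m).
- apply: reval_comp3 rk; [|exact: (@reval_proj 0)|exact: (@reval_proj 1)].
  (* [RMin] expects values [(w i).+1] before the minimum; they are all [true], that is 1, so [w] is
     constantly 0. *)
  apply: (@reval_min _ _ _ (fun=> 0)) => [t lt_tT|].
    by have := reval_continue t; rewrite cont.
  by have := reval_continue T; rewrite stop.
- exact: (@reval_proj 1).
apply: reval_comp2 (reval_guard_succ _ _); last exact: (@reval_proj 0).
apply: reval_comp2 (reval_le k_x m_a').
  exact: (@reval_proj 0).
exact: (@reval_proj 1).
Qed.

End Program.

Theorem corollary3p5
  (dC dA : Order.disp_t) (C : porderType dC) (A : joinSemilatticeType dA)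
  (alpha : C -> A) (gamma : A -> C) (f : C -> C) (nu : numbering A)
  (hGI : galois_insertion alpha gamma)
  (hC : complete_lattice C)
  (hf : {homo f : x y / (x <= y)%O})
  (hjoin : computable2 nu nu nu (fun a b : A => Order.join a b))
  (hafg : computable1 nu nu (fun a : A => alpha (f (gamma a))))
  (hle : decidable_rel nu (fun a b : A => (a <= b)%O))
  (hcpo : cpo A)
  (hacc : ascending_chain_condition A) :
  exists p : recfun,
    forall (c : C) (a' : A), computable0 nu (alpha c) ->
    exists r : option A,
      [/\ AInv alpha gamma f c a' r,
          forall n m, names nu n (alpha c) -> names nu m a' ->
            exists k, reval p [:: n; m] k /\ names (option_numbering nu) k r,
          (exists a, abstract_inductive_invariant gamma f c (gamma a') a) ->
            exists a, r = Some a /\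
              least_abstract_inductive_invariant gamma f c (gamma a') a
        & ~ (exists a, abstract_inductive_invariant gamma f c (gamma a') a) ->
            r = None].
Proof.
have [pj pjP] := hjoin; have [pf pfP] := hafg; have [pl plP] := hle.
pose F a := alpha (f (gamma a)).
have F_homo : {homo F : x y / (x <= y)%O}.
  case: hGI => adj _ x y le_xy; apply: (galois_alpha_homo adj).
  exact/hf/(galois_gamma_homo adj).
(* The program is fixed before [c] and [a'], so it is uniform in both. *)
exists (rec_AInv pj pf pl) => c a' _; pose x := join_iter F (alpha c).
pose stop t := ~~ ((x t <= a')%O && ~~ (F (x t) <= x t)%O).
have stops : exists t, stop t.
  have [t le_F] := join_iter_postfixpoint (alpha c) F_homo hacc.
  by exists t; rewrite /stop le_F andbF.
case: (ex_minnP stops) => T stopT minT.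
have cont t : t < T -> (x t <= a')%O && ~~ (F (x t) <= x t)%O.
  by rewrite ltnNge; apply: contraR => /minT.
(* The first bound gives leastness; by transitivity the two together exclude the output [None]. *)
have below b : abstract_inductive_invariant gamma f c (gamma a') b ->
    (x T <= b)%O /\ (b <= a')%O.
  move=> /(abstract_inductive_invariantE f c a' _ hGI)[le_c le_F le_a'].
  by split=> //; apply: join_iter_le_postfixpoint.
exists (if (x T <= a')%O then Some (x T) else None); split.
- exact: AInv_join_iter.
- by move=> n m n_c m_a'; apply: reval_AInv.
- move=> [b inv_b]; have [le_xb le_ba'] := below b inv_b.
  have le_xa' := le_trans le_xb le_ba'.
  exists (x T); rewrite le_xa'; split=> //; split=> [|b' /below[]//].
  apply/(abstract_inductive_invariantE f c a' _ hGI); split=> //.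
    exact: join_iter_ge.
  (* As [x T <= a'], the loop can only have stopped because [F (x T) <= x T]. *)
  by move: stopT; rewrite /stop le_xa' /= negbK.
(* Had the loop stopped below [a'], then [x T] itself would be an invariant. *)
- case: ifPn => // le_xa' [].
  exists (x T); apply/(abstract_inductive_invariantE f c a' _ hGI); split=> //.
    exact: join_iter_ge.
  by move: stopT; rewrite /stop le_xa' /= negbK.
Qed.
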